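(* Let $X$ be either the complex sequence space $l^p$ for some $1 \le p < \infty$ or the complex sequence space $c_0$, and let $\mu$ be a complex number. Let $X = X_1 \oplus X_2$, where $X_1$ is the closed linear span of $\{e_{2n} : n \ge 1\}$ and $X_2$ is the closed linear span of $\{e_{2n-1} : n \ge 1\}$, let $P = \left(\begin{matrix} I_1 & 0 \\ 0 & 0 \end{matrix}\right)$ with respect to this decomposition, and let $S_0 = \left(\begin{matrix} 0 & I \\ S & 0 \end{matrix}\right)$ be the block form of the unilateral forward shift $S$ on $X$ with respect to this decomposition. Then $\mu S_0$ is a commutator of the idempotent $P$ and some idempotent operator $Q$ on $X$ if and only if $|\mu| \le \frac12$.
   Context: ''Operator'' means bounded linear operator. $\{e_n\}_{n \ge 1}$ denotes the standard unit vectors of $X$. The unilateral forward shift on $X$ is $S(x_1, x_2, x_3, \ldots) = (0, x_1, x_2, x_3, \ldots)$. $I_1$ is the identity operator on $X_1$, so $P$ is the projection onto $X_1$ along $X_2$ ($P e_{2n} = e_{2n}$, $P e_{2n-1} = 0$). In the block form $S_0$, each of $X_1$ and $X_2$ is identified with the sequence space $X$ via $e_{2n} \leftrightarrow e_n$ and $e_{2n-1} \leftrightarrow e_n$ respectively; under these identifications $S$ maps $X_2$ to $X_1$ as the identity $I$ ($e_{2n-1} \mapsto e_{2n}$) and $X_1$ to $X_2$ as the forward shift $S$ ($e_{2n} \mapsto e_{2n+1}$). Thus $S_0$ is just the forward shift on $X$ written with respect to $X = X_1 \oplus X_2$. An operator $Q$ is idempotent if $Q^2 = Q$. An operator $T$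 is a commutator of $P$ and $Q$ if $T = PQ - QP$. *)

(* Defs.v *)
From HB Require Import structures.
From mathcomp Require Import all_boot all_order all_algebra.
From mathcomp Require Import complex.
From mathcomp Require Import all_classical all_reals all_analysis.

Set Implicit Arguments.
Unset Strict Implicit.
Unset Printing Implicit Defensive.

Import Order.TTheory GRing.Theory Num.Theory.
Import numFieldNormedType.Exports.

Local Open Scope classical_set_scope.
Local Open Scope ring_scope.
Local Open Scope complex_scope.

(* Re `|z| is the modulus of z as an element of R. *)
Definition modulus (R : rcfType) (z : R[i]) : R := complex.Re `|z|.

Section modulus.
Variable R : realType.
Implicit Types z w : R[i].

Lemma modulusE z : `|z| = (modulus z)%:C.
Proof. by rewrite /modulus normc_def. Qed.

Lemma modulus_ge0 z : 0 <= modulus z.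
Proof. by rewrite -ler0c -modulusE. Qed.

Lemma modulus0 : modulus (0 : R[i]) = 0.
Proof. by rewrite /modulus normr0. Qed.

Lemma modulus_eq0 z : modulus z = 0 -> z = 0.
Proof. by move=> z0; apply/eqP; rewrite -normr_eq0 modulusE z0. Qed.

Lemma modulusD z w : modulus (z + w) <= modulus z + modulus w.
Proof. by rewrite -lecR rmorphD/= -!modulusE ler_normD. Qed.

Lemma modulusM z w : modulus (z * w) = modulus z * modulus w.
Proof. by apply: complexI; rewrite rmorphM/= -!modulusE normrM. Qed.

End modulus.

(* The two kinds of spaces considered: l^p with 1 <= p < +oo, and c_0. *)
Inductive seq_space (R : realType) :=
  | ellp (p : R) of 1 <= p
  | czero.
Arguments czero {R}.

Section spaces.
Variable R : realType.
Implicit Types (X : seq_space R) (x y : nat -> R[i]^o).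

Definition in_seq_space X x : Prop :=
  match X with
  | ellp p _ => (\sum_(n <oo) (modulus (x n) `^ p)%:E < +oo)%E
  | czero => modulus (x n) @[n --> \oo] --> (0 : R)
  end.

Definition seq_norm X x : R :=
  match X with
  | ellp p _ => fine (\sum_(n <oo) (modulus (x n) `^ p)%:E)%E `^ p^-1
  | czero => sup (range (fun n => modulus (x n)))
  end.

Let psum p x := (\sum_(n <oo) (modulus (x n) `^ p)%:E)%E.

Let psum_ge0 p x : (0 <= psum p x)%E.
Proof. by apply: nneseries_ge0 => n _ _; rewrite lee_fin powR_ge0. Qed.

Let psum_poweR p x (p1 : 1 <= p) :
  (psum p x `^ p^-1)%E = 'N[counting]_p%:E[EFin \o (fun n => modulus (x n))]%E.
Proof.
rewrite Lnorm_counting ?(lt_le_trans ltr01)//; congr (_ `^ _)%E.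
apply: eq_eseriesr => n _ /=.
by rewrite ger0_norm ?modulus_ge0// poweR_EFin.
Qed.

Let psum_lty p x (p1 : 1 <= p) :
  ('N[counting]_p%:E[EFin \o (fun n => modulus (x n))] < +oo)%E ->
  (psum p x < +oo)%E.
Proof.
rewrite -psum_poweR// => h; apply: (@lty_poweRy _ _ p^-1) => //.
by rewrite invr_neq0// gt_eqF// (lt_le_trans ltr01).
Qed.

Let norm_fine p x (p1 : 1 <= p) : (psum p x < +oo)%E ->
  (seq_norm (ellp p1) x)%:E =
  'N[counting]_p%:E[EFin \o (fun n => modulus (x n))]%E.
Proof.
move=> h; rewrite -psum_poweR// /seq_norm -/(psum p x) -poweR_EFin fineK//.
by rewrite ge0_fin_numE.
Qed.

Let minkowski_seq p x y : 1 <= p ->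
  ('N[counting]_p%:E[EFin \o (fun n => modulus (x n + y n)%R)] <=
   'N[counting]_p%:E[EFin \o (fun n => modulus (x n))] +
   'N[counting]_p%:E[EFin \o (fun n => modulus (y n))])%E.
Proof.
move=> p1; pose m u := fun n : nat => modulus (u n : R[i]).
have mm u : measurable_fun [set: nat] (m u) by [].
apply: le_trans (minkowski_EFin counting (mm x) (mm y) p1).
rewrite !Lnorm_counting ?(lt_le_trans ltr01)//.
apply: gt0_ler_poweR.
- by rewrite invr_ge0 (le_trans ler01).
- by rewrite in_itv/= leey andbT; apply: nneseries_ge0 => n _ _; rewrite lee_fin powR_ge0.
- by rewrite in_itv/= leey andbT; apply: nneseries_ge0 => n _ _; rewrite lee_fin powR_ge0.
apply: lee_nneseries => n _; rewrite ?poweR_ge0//=.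
rewrite lee_fin; apply: ge0_ler_powR; rewrite ?nnegrE//.
  by rewrite (le_trans ler01).
by rewrite /m !ger0_norm ?addr_ge0 ?modulus_ge0 ?modulusD.
Qed.


Let c0_ub x : in_seq_space czero x ->
  has_ubound (range (fun n => modulus (x n))).
Proof.
move=> /cvgP/cvg_seq_bounded => -[M [Mr hM]].
exists (M + 1) => _ [n _ <-].
have M1 : M < M + 1 by rewrite ltrDl.
by have := hM _ M1 n I; rewrite /= ger0_norm ?modulus_ge0.
Qed.

Let c0_le x n : in_seq_space czero x -> modulus (x n) <= seq_norm czero x.
Proof. by move=> xc; apply: ub_le_sup; [exact: c0_ub|exists n]. Qed.

Let c0_sup_le x M : (forall n, modulus (x n) <= M) -> seq_norm czero x <= M.
Proof.
move=> xM; apply: ge_sup; first by exists (modulus (x 0%N)), 0%N.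
by move=> _ [n _ <-].
Qed.

Lemma in_seq_space0 X : in_seq_space X 0.
Proof.
case: X => [p p1|] /=.
  rewrite eseries0// => n _ _; rewrite modulus0 powR0//.
  by rewrite gt_eqF// (lt_le_trans ltr01).
under eq_fun do rewrite modulus0.
exact: cvg_cst.
Qed.

Lemma in_seq_spaceD X x y :
  in_seq_space X x -> in_seq_space X y -> in_seq_space X (x + y).
Proof.
case: X => [p p1|] /= xX yX.
  apply: (psum_lty p1); apply: (le_lt_trans (minkowski_seq _ _ p1)).
  by rewrite -(norm_fine p1 xX) -(norm_fine p1 yX) -EFinD ltry.
apply: (@squeeze_cvgr _ _ _ _ (cst 0)
    (fun n => modulus (x n) + modulus (y n))).
- by apply: nearW => n; rewrite modulus_ge0 modulusD.
- exact: cvg_cst.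
- by rewrite -[X in _ --> X]addr0; exact: cvgD.
Qed.

Let psumZ p (a : R[i]) x : 1 <= p ->
  psum p (a *: x) = ((modulus a `^ p)%:E * psum p x)%E.
Proof.
move=> p1; rewrite /psum -nneseriesZl; last first.
  by move=> n _; rewrite lee_fin powR_ge0.
apply: eq_eseriesr => n _; rewrite -EFinM -powRM ?modulus_ge0//.
by rewrite -modulusM.
Qed.

Lemma in_seq_spaceZ X (a : R[i]) x :
  in_seq_space X x -> in_seq_space X (a *: x).
Proof.
case: X => [p p1|] /= xX.
  by rewrite -/(psum p _) psumZ// lte_mul_pinfty// lee_fin powR_ge0.
rewrite (_ : (fun n => _) = (fun n => modulus a * modulus (x n))); last first.
  by apply/funext => n; rewrite -modulusM.
by rewrite -[X in _ --> X](mulr0 (modulus a)); apply: cvgMr.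
Qed.

Lemma seq_normD X x y : in_seq_space X x -> in_seq_space X y ->
  seq_norm X (x + y) <= seq_norm X x + seq_norm X y.
Proof.
move=> xX yX; have := in_seq_spaceD xX yX; case: X xX yX => [p p1|] xX yX xyX.
  have le_aux (a b c : R) (A B C : \bar R) :
    a%:E = A -> b%:E = B -> c%:E = C -> (C <= A + B)%E -> c <= a + b.
    by move=> <- <- <-; rewrite -EFinD lee_fin.
  exact: (le_aux _ _ _ _ _ _ (norm_fine p1 xX) (norm_fine p1 yX)
    (norm_fine p1 xyX) (minkowski_seq x y p1)).
apply: c0_sup_le => n; apply: (le_trans (modulusD _ _)).
by apply: lerD; exact: c0_le.
Qed.

Lemma seq_normZ X (a : R[i]) x : in_seq_space X x ->
  seq_norm X (a *: x) = modulus a * seq_norm X x.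
Proof.
move=> xX; have := in_seq_spaceZ a xX; case: X xX => [p p1|] xX axX.
  rewrite /seq_norm -/(psum p x) -/(psum p (a *: x)) psumZ// fineM//; last by rewrite ge0_fin_numE.
  rewrite powRM ?fine_ge0 ?powR_ge0 ?psum_ge0 ?lee_fin ?powR_ge0//=.
  rewrite -powRrM divff ?powRr1 ?modulus_ge0//.
  by rewrite gt_eqF// (lt_le_trans ltr01).
apply/eqP; rewrite eq_le; apply/andP; split.
  apply: c0_sup_le => n; rewrite [leLHS](modulusM a (x n)).
  by rewrite ler_wpM2l ?modulus_ge0// c0_le.
have [->|a0] := eqVneq (modulus a) 0.
  by rewrite mul0r (le_trans (modulus_ge0 _) (c0_le 0%N axX)).
have a_gt0 : 0 < modulus a by rewrite lt_neqAle eq_sym a0 modulus_ge0.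
rewrite -ler_pdivlMl//; apply: c0_sup_le => n.
by rewrite ler_pdivlMl// -modulusM; exact: (c0_le n axX).
Qed.

Lemma modulus_le_seq_norm X x n : in_seq_space X x ->
  modulus (x n) <= seq_norm X x.
Proof.
case: X => [p p1|] xX; last exact: c0_le.
have p0 : 0 < p by rewrite (lt_le_trans ltr01).
rewrite -[leLHS]powRr1 ?modulus_ge0// -(@mulfV _ p) ?gt_eqF// powRrM.
rewrite /= -/(psum p x).
have xp : modulus (x n) `^ p <= fine (psum p x).
  rewrite -lee_fin fineK ?ge0_fin_numE//.
  apply: (le_trans _ (nneseries_lim_ge n.+1 (fun k _ _ => _))) => [|k _ _].
    rewrite big_mkord big_ord_recr/= leeDr// sume_ge0// => k _.
    by rewrite lee_fin powR_ge0.
  by rewrite lee_fin powR_ge0.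
by apply: ge0_ler_powR; rewrite ?nnegrE ?invr_ge0 ?powR_ge0 ?(ltW p0) ?fine_ge0.
Qed.

End spaces.

Section lseq.
Variables (R : realType) (X : seq_space R).

Definition in_seq_space_pred : {pred nat -> R[i]^o} :=
  mem [set x | in_seq_space X x].

Lemma in_seq_space_submod_closed : submod_closed in_seq_space_pred.
Proof.
split; first by apply: mem_set; exact: in_seq_space0.
move=> a x y /set_mem xX /set_mem yX; apply: mem_set.
exact/in_seq_spaceD/yX/in_seq_spaceZ.
Qed.

HB.instance Definition _ :=
  GRing.isSubmodClosed.Build _ _ in_seq_space_pred in_seq_space_submod_closed.

Record lseq : Type := LSeq {
  lseq_val :> nat -> R[i]^o ;
  lseq_valP : lseq_val \in in_seq_space_pred }.

HB.instance Definition _ := [isSub for lseq_val].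
HB.instance Definition _ := [Choice of lseq by <:].
HB.instance Definition _ := [SubChoice_isSubLmodule of lseq by <:].

Lemma lseqP (x : lseq) : in_seq_space X x.
Proof. exact: (set_mem (lseq_valP x)). Qed.

Definition mk_lseq (x : nat -> R[i]^o) (xX : in_seq_space X x) : lseq :=
  LSeq (mem_set xX).

Lemma lseq_ext (x y : lseq) : x =1 y -> x = y.
Proof. by move=> xy; apply/val_inj/funext. Qed.

Let norm (x : lseq) : R[i] := (seq_norm X x)%:C.

Let norm_ler_normD x y : norm (x + y) <= norm x + norm y.
Proof. by rewrite -rmorphD lecR; apply: seq_normD; exact: lseqP. Qed.

Let norm_normrZ (a : R[i]) x : norm (a *: x) = `|a| * norm x.
Proof.
by rewrite modulusE -rmorphM; congr _%:C; apply: seq_normZ; exact: lseqP.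
Qed.

Let norm_eq0 x : norm x = 0 -> x = 0.
Proof.
move=> /complexI x0; apply: lseq_ext => n; apply: modulus_eq0.
apply/eqP; rewrite eq_le modulus_ge0 andbT -x0.
exact/modulus_le_seq_norm/lseqP.
Qed.

HB.instance Definition _ := Lmodule_isNormed.Build R[i] lseq
  norm_ler_normD norm_normrZ norm_eq0.

Lemma lseq_normE (x : lseq) : `|x| = (seq_norm X x)%:C.
Proof. by []. Qed.

End lseq.

Coercion lseq : seq_space >-> Sortclass.

(* Reading a sequence through a partial injection of the indices, with value 0
   where the injection is undefined, does not increase the norm. *)
Section reindex.
Variables (R : realType) (X : seq_space R) (h : nat -> option nat).
Hypothesis h_inj : forall i j m, h i = Some m -> h j = Some m -> i = j.
Implicit Types x y : nat -> R[i]^o.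

Definition reindex x : nat -> R[i]^o := fun k => oapp x 0 (h k).

Let h_infty N : exists K, forall k m, (K <= k)%N -> h k = Some m -> (N <= m)%N.
Proof.
elim: N => [|N [K hK]]; first by exists 0%N.
have [[k0 hk0]|nk] := pselect (exists k, h k = Some N).
  exists (maxn K k0.+1) => k m; rewrite geq_max => /andP[Kk k0k] hkm.
  rewrite ltn_neqAle (hK _ _ Kk hkm) andbT; apply: contraTneq k0k => Nm.
  by rewrite (h_inj hk0 (etrans hkm (congr1 Some (esym Nm)))) ltnn.
exists K => k m Kk hkm; rewrite ltn_neqAle (hK _ _ Kk hkm) andbT.
by apply/eqP => Nm; apply: nk; exists k; rewrite Nm.
Qed.

Let sum_pmap (F : nat -> R) n :
  \sum_(k < n) oapp F 0 (h k) = \sum_(m <- pmap h (iota 0 n)) F m.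
Proof.
rewrite -(big_mkord xpredT (fun k => oapp F 0 (h k))) /index_iota subn0.
elim: (iota 0 n) => [|k s ih]; first by rewrite !big_nil.
by rewrite big_cons ih /=; case: (h k) => [m|] /=; rewrite ?big_cons ?add0r.
Qed.

Let uniq_pmap n : uniq (pmap h (iota 0 n)).
Proof.
elim: (iota 0 n) (iota_uniq 0 n) => [//|k s ih] /= /andP[ks us].
case E: (h k) => [m|] /=; rewrite ih// andbT.
apply: contra ks; rewrite mem_pmap => /mapP[j js /esym hj].
by rewrite (h_inj E hj).
Qed.

Let sum_reindex_le (F : nat -> R) n : (forall m, 0 <= F m) ->
  exists N, \sum_(k < n) oapp F 0 (h k) <= \sum_(m < N) F m.
Proof.
move=> F0; rewrite sum_pmap; set s := pmap h _.
exists (\max_(m <- s) m).+1; rewrite -(big_mkord xpredT F).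
rewrite [leRHS](bigID (mem s))/= -[leLHS]addr0; apply: lerD; last first.
  by apply: sumr_ge0.
rewrite -[leRHS]big_filter /index_iota subn0 le_eqVlt; apply/orP; left; apply/eqP.
apply: perm_big.
apply: uniq_perm => [||m]; first exact: uniq_pmap.
  by rewrite filter_uniq ?iota_uniq.
rewrite mem_filter mem_iota/= add0n ltnS; case: (boolP (m \in s)) => //= ms.
by rewrite (@leq_bigmax_seq _ s xpredT id).
Qed.

Lemma in_seq_space_reindex_norm x : in_seq_space X x ->
  in_seq_space X (reindex x) /\ seq_norm X (reindex x) <= seq_norm X x.
Proof.
case: X => [p p1|] xX.
  have p0 : p != 0 by rewrite gt_eqF// (lt_le_trans ltr01).
  set S := (\sum_(n <oo) (modulus (x n) `^ p)%:E)%E.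
  have le_S : (\sum_(n <oo) (modulus (reindex x n) `^ p)%:E <= S)%E.
    apply: lime_le.
      by apply: is_cvg_nneseries => *; rewrite lee_fin powR_ge0.
    apply: nearW => n; rewrite big_mkord.
    have [|N hN] := @sum_reindex_le (fun m => modulus (x m) `^ p) n.
      by move=> m; rewrite powR_ge0.
    rewrite sumEFin (_ : \sum_(i < n) _ =
        \sum_(k < n) oapp (fun m => modulus (x m) `^ p) 0 (h k)); last first.
      apply: eq_bigr => k _; rewrite /reindex; case: (h k) => //=.
      by rewrite modulus0 powR0.
    apply: (@le_trans _ _ (\sum_(m < N) modulus (x m) `^ p)%:E).
      by rewrite lee_fin.
    rewrite -sumEFin -(big_mkord xpredT (fun m => (modulus (x m) `^ p)%:E)).
    by apply: nneseries_lim_ge => *; rewrite lee_fin powR_ge0.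
  have ge0 y : (0 <= \sum_(n <oo) (modulus (y n) `^ p)%:E)%E.
    by apply: nneseries_ge0 => *; rewrite lee_fin powR_ge0.
  have rX : in_seq_space (ellp p1) (reindex x) by exact: le_lt_trans xX.
  split; first exact: rX.
  have le_fine : fine (\sum_(n <oo) (modulus (reindex x n) `^ p)%:E)%E <= fine S.
    by apply: fine_le; [rewrite ge0_fin_numE; [exact: rX|exact: ge0]
                       |rewrite ge0_fin_numE; [exact: xX|exact: ge0]|].
  rewrite /seq_norm; apply: ge0_ler_powR le_fine.
  - by rewrite invr_ge0 (le_trans ler01).
  - by rewrite nnegrE fine_ge0.
  - by rewrite nnegrE fine_ge0// ge0.
have xle n : modulus (x n) <= seq_norm czero x.
  exact: (@modulus_le_seq_norm _ czero).
have rX : in_seq_space czero (reindex x).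
  apply/cvgrPdist_le => e e0.
  move/cvgrPdist_le : xX => /(_ _ e0)[N _ hN].
  have [K hK] := h_infty N; exists K => // k /= Kk; rewrite /reindex.
  case E : (h k) => [m|] /=; first by apply: hN; exact: hK E.
  by rewrite modulus0 subrr normr0 ltW.
split=> //; apply: ge_sup; first by exists (modulus (reindex x 0%N)), 0%N.
move=> _ [n _ <-]; rewrite /reindex; case: (h n) => [m|]/=; first exact: xle.
by rewrite modulus0 (le_trans _ (xle 0%N))// modulus_ge0.
Qed.

End reindex.

Section operator_theory.
Variables (R : realType) (V : normedModType R[i]).
Implicit Types (A W : set V) (T P Q : V -> V).

Definition bounded_operator T := exists M : R, forall x, `|T x| <= M%:C * `|x|.

Definition idempotent_operator Q := forall x, Q (Q x) = Q x.

Definition is_commutator T P Q := forall x, T x = P (Q x) - Q (P x).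

Definition subspace_set W :=
  W 0 /\ forall (a : R[i]) x y, W x -> W y -> W (a *: x + y).

Definition closed_span A : set V :=
  smallest [set W | closed W /\ subspace_set W] A.

Lemma bounded_operator_continuous (T : {linear V -> V}) :
  bounded_operator T -> continuous T.
Proof.
move=> [M TM]; apply: bounded_linear_continuous; apply/linear_boundedP.
exists M%:C; split; first by apply/complex_realP; exists M.
move=> r Mr x; apply: le_trans (TM x) _; apply: ler_wpM2r => //; exact: ltW.
Qed.

End operator_theory.

(* A sequence (x_1, x_2, ...) is represented by the function k |-> x_(k+1), so
   the positions 2n and 2n-1 (n >= 1) are the odd and even arguments. *)
Section operators.
Variables (R : realType) (X : seq_space R).
Implicit Types x y : X.

Let lseqD x y k : (x + y) k = x k + y k.
Proof. by []. Qed.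

Let lseqDZ (a : R[i]) x y k : (a *: x + y) k = a * x k + y k.
Proof. by []. Qed.

Let reindexP (h : nat -> option nat) x (y : nat -> R[i]^o) :
  (forall i j m, h i = Some m -> h j = Some m -> i = j) ->
  y =1 reindex h x ->
  in_seq_space X y /\ seq_norm X y <= seq_norm X x.
Proof.
move=> h_inj /funext ->.
exact: (in_seq_space_reindex_norm h_inj (lseqP x)).
Qed.

(* unit_vec n is e_n for n >= 1. *)
Lemma unit_vec_subproof (n : nat) : in_seq_space X (fun k => (k.+1 == n)%:R).
Proof.
case: X => [p p1|].
  have p0 : p != 0 by rewrite gt_eqF// (lt_le_trans ltr01).
  rewrite /in_seq_space (nneseries_split 0 n); last first.
    by move=> *; rewrite lee_fin powR_ge0.
  rewrite add0n [X in (_ + X)%E]eseries0 ?adde0.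
    by rewrite sumEFin ltry.
  move=> k nk _; rewrite gtn_eqF ?ltnS// modulus0 powR0//.
apply: cvg_near_cst; exists n => // k /= nk.
by rewrite gtn_eqF ?ltnS// modulus0.
Qed.
Definition unit_vec n : X := mk_lseq (unit_vec_subproof n).

Definition X1 : set X :=
  closed_span [set unit_vec n.*2 | n in [set n | (1 <= n)%N]].
Definition X2 : set X :=
  closed_span [set unit_vec n.*2.-1 | n in [set n | (1 <= n)%N]].

Let shift_idx k := if k is k'.+1 then Some k' else None.
Let shiftP x := @reindexP shift_idx x (fun k => if k is k'.+1 then x k' else 0).
Let shift_subproof x :
  in_seq_space X (fun k => if k is k'.+1 then x k' else 0) /\
  seq_norm X (fun k => if k is k'.+1 then x k' else 0) <= seq_norm X x.
Proof.
by apply: shiftP => [[|i] [|j] //= m [->] [->]|[]].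
Qed.
Definition shift x : X := mk_lseq (shift_subproof x).1.

(* inj1 and inj2 identify X with X1 through e_n <-> e_(2n) and with X2 through
   e_n <-> e_(2n-1); coord1 and coord2 are the components along X = X1 (+) X2,
   read through these identifications. See inj1_unit_vec, inj2_unit_vec, X1E,
   X2E and inj_coord below. *)
Let inj1_idx k := if odd k then Some k./2 else None.
Let inj1_subproof x :
  in_seq_space X (fun k => if odd k then x k./2 else 0) /\
  seq_norm X (fun k => if odd k then x k./2 else 0) <= seq_norm X x.
Proof.
apply: (@reindexP inj1_idx) => [i j m|k]; last first.
  by rewrite /reindex /inj1_idx; case: ifP.
rewrite /inj1_idx; case: ifP => // oi [im]; case: ifP => // oj [jm].
by rewrite -(odd_double_half i) -(odd_double_half j) oi oj im jm.
Qed.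
Definition inj1 x : X := mk_lseq (inj1_subproof x).1.

Let inj2_idx k := if odd k then None else Some k./2.
Let inj2_subproof x :
  in_seq_space X (fun k => if odd k then 0 else x k./2) /\
  seq_norm X (fun k => if odd k then 0 else x k./2) <= seq_norm X x.
Proof.
apply: (@reindexP inj2_idx) => [i j m|k]; last first.
  by rewrite /reindex /inj2_idx; case: ifP.
rewrite /inj2_idx; case: ifP => // oi [im]; case: ifP => // oj [jm].
by rewrite -(odd_double_half i) -(odd_double_half j) oi oj im jm.
Qed.
Definition inj2 x : X := mk_lseq (inj2_subproof x).1.

Let coord1_subproof x :
  in_seq_space X (fun k => x k.*2.+1) /\
  seq_norm X (fun k => x k.*2.+1) <= seq_norm X x.
Proof.
apply: (@reindexP (fun k => Some k.*2.+1)) => [i j m [<-] [ji]|k] //.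
exact/esym/double_inj.
Qed.
Definition coord1 x : X := mk_lseq (coord1_subproof x).1.

Let coord2_subproof x :
  in_seq_space X (fun k => x k.*2) /\
  seq_norm X (fun k => x k.*2) <= seq_norm X x.
Proof.
apply: (@reindexP (fun k => Some k.*2)) => [i j m [<-] [ji]|k] //.
exact/esym/double_inj.
Qed.
Definition coord2 x : X := mk_lseq (coord2_subproof x).1.

Lemma norm_shift x : `|shift x| <= `|x|.
Proof. by rewrite !lseq_normE lecR; exact: (shift_subproof x).2. Qed.

Lemma norm_inj1 x : `|inj1 x| <= `|x|.
Proof. by rewrite !lseq_normE lecR; exact: (inj1_subproof x).2. Qed.

Lemma norm_inj2 x : `|inj2 x| <= `|x|.
Proof. by rewrite !lseq_normE lecR; exact: (inj2_subproof x).2. Qed.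

Lemma norm_coord1 x : `|coord1 x| <= `|x|.
Proof. by rewrite !lseq_normE lecR; exact: (coord1_subproof x).2. Qed.

Lemma norm_coord2 x : `|coord2 x| <= `|x|.
Proof. by rewrite !lseq_normE lecR; exact: (coord2_subproof x).2. Qed.

Let shift_linear : linear shift.
Proof.
by move=> a x y; apply: lseq_ext => -[|k]; rewrite lseqDZ//= mulr0 addr0.
Qed.
HB.instance Definition _ :=
  GRing.isLinear.Build R[i] X X _ shift shift_linear.

Let inj1E x k : inj1 x k = if odd k then x k./2 else 0.
Proof. by []. Qed.

Let inj1_linear : linear inj1.
Proof.
move=> a x y; apply: lseq_ext => k; rewrite lseqDZ !inj1E lseqDZ.
by case: ifP => // _; rewrite mulr0 addr0.
Qed.
HB.instance Definition _ :=
  GRing.isLinear.Build R[i] X X _ inj1 inj1_linear.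

Let inj2E x k : inj2 x k = if odd k then 0 else x k./2.
Proof. by []. Qed.

Let inj2_linear : linear inj2.
Proof.
move=> a x y; apply: lseq_ext => k; rewrite lseqDZ !inj2E lseqDZ.
by case: ifP => // _; rewrite mulr0 addr0.
Qed.
HB.instance Definition _ :=
  GRing.isLinear.Build R[i] X X _ inj2 inj2_linear.

Let coord1_linear : linear coord1.
Proof. by move=> a x y; exact: lseq_ext. Qed.
HB.instance Definition _ :=
  GRing.isLinear.Build R[i] X X _ coord1 coord1_linear.

Let coord2_linear : linear coord2.
Proof. by move=> a x y; exact: lseq_ext. Qed.
HB.instance Definition _ :=
  GRing.isLinear.Build R[i] X X _ coord2 coord2_linear.

Section block.
Variables A B C D : {linear X -> X}.

(* The operator with block matrix ((A, B), (C, D)) on X = X1 (+) X2. *)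
Definition block_op (x : X) : X :=
  inj1 (A (coord1 x) + B (coord2 x)) + inj2 (C (coord1 x) + D (coord2 x)).

Let block_op_linear : linear block_op.
Proof.
have linAB (A' B' : {linear X -> X}) a x y :
    A' (coord1 (a *: x + y)) + B' (coord2 (a *: x + y)) =
    a *: (A' (coord1 x) + B' (coord2 x)) + (A' (coord1 y) + B' (coord2 y)).
  by rewrite !linearP scalerDr addrACA.
by move=> a x y; rewrite /block_op !linAB !linearP scalerDr addrACA.
Qed.
HB.instance Definition _ :=
  GRing.isLinear.Build R[i] X X _ block_op block_op_linear.

End block.

Definition op_P : {linear X -> X} := block_op idfun \0 \0 \0.
Definition op_S0 : {linear X -> X} := block_op \0 idfun shift \0.

Let nonexpansive_bounded (T : X -> X) :
  (forall x, `|T x| <= `|x|) -> bounded_operator T.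
Proof. by move=> TM; exists 1 => x; rewrite mul1r. Qed.

Lemma inj1_continuous : continuous inj1.
Proof. exact/bounded_operator_continuous/nonexpansive_bounded/norm_inj1. Qed.

Lemma inj2_continuous : continuous inj2.
Proof. exact/bounded_operator_continuous/nonexpansive_bounded/norm_inj2. Qed.

Lemma coord1_continuous : continuous coord1.
Proof.
exact/bounded_operator_continuous/nonexpansive_bounded/norm_coord1.
Qed.

Lemma coord2_continuous : continuous coord2.
Proof.
exact/bounded_operator_continuous/nonexpansive_bounded/norm_coord2.
Qed.

Lemma inj1_unit_vec n : (1 <= n)%N -> inj1 (unit_vec n) = unit_vec n.*2.
Proof.
case: n => // n _; apply: lseq_ext => k /=; rewrite doubleS !eqSS.
have [ok|ek] := boolP (odd k).
  by rewrite -{2}(odd_double_half k) ok eqSS (inj_eq double_inj).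
by case: eqP => // kn; rewrite kn /= odd_double in ek.
Qed.

Lemma inj2_unit_vec n : (1 <= n)%N -> inj2 (unit_vec n) = unit_vec n.*2.-1.
Proof.
case: n => // n _; apply: lseq_ext => k /=; rewrite !eqSS.
have [ok|ek] := boolP (odd k).
  by case: eqP => // kn; rewrite kn odd_double in ok.
by rewrite -{2}(odd_double_half k) (negbTE ek) add0n (inj_eq double_inj).
Qed.

Lemma coord1K : cancel inj1 coord1.
Proof.
by move=> x; apply: lseq_ext => k /=; rewrite odd_double uphalf_double.
Qed.

Lemma coord2K : cancel inj2 coord2.
Proof. by move=> x; apply: lseq_ext => k /=; rewrite odd_double doubleK. Qed.

Lemma coord1_inj2 x : coord1 (inj2 x) = 0.
Proof. by apply: lseq_ext => k /=; rewrite odd_double. Qed.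

Lemma coord2_inj1 x : coord2 (inj1 x) = 0.
Proof. by apply: lseq_ext => k /=; rewrite odd_double. Qed.

Lemma inj_coord x : inj1 (coord1 x) + inj2 (coord2 x) = x.
Proof.
apply: lseq_ext => k.
rewrite lseqD inj1E inj2E /=.
have := odd_double_half k; case: (odd k) => kE.
  by rewrite addr0 -{2}kE.
by rewrite add0r -{2}kE.
Qed.

Lemma op_S0_shift x : op_S0 x = shift x.
Proof.
apply: lseq_ext => k.
rewrite (_ : op_S0 x = inj1 (coord2 x) + inj2 (shift (coord1 x))); last first.
  by rewrite /op_S0/= /block_op/= add0r addr0.
rewrite lseqD inj1E inj2E /=; have := odd_double_half k.
case: (odd k) => <- /=.
  by rewrite uphalf_double addr0.
rewrite add0n doubleK add0r.
by case: (k./2).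
Qed.

Lemma op_PE x : op_P x = inj1 (coord1 x).
Proof. by rewrite /op_P/= /block_op/= !addr0 linear0 addr0. Qed.

Lemma op_P_idempotent : idempotent_operator op_P.
Proof. by move=> x; rewrite !op_PE coord1K. Qed.

Lemma op_P_bounded : bounded_operator op_P.
Proof.
apply: nonexpansive_bounded => x; rewrite op_PE.
exact: le_trans (norm_inj1 _) (norm_coord1 _).
Qed.

Lemma op_S0_bounded : bounded_operator op_S0.
Proof.
by apply: nonexpansive_bounded => x; rewrite op_S0_shift norm_shift.
Qed.

Let truncate n x : X := \sum_(k < n) x k *: unit_vec k.+1.

Let truncateE n x k : truncate n x k = if (k < n)%N then x k else 0.
Proof.
elim: n => [|n ih]; first by rewrite /truncate big_ord0.
have -> : truncate n.+1 x = truncate n x + x n *: unit_vec n.+1.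
  by rewrite /truncate big_ord_recr.
rewrite lseqD ih (_ : (x n *: unit_vec n.+1) k = x n * (k == n)%:R)//.
by rewrite ltnS; case: ltngtP => [||->]; rewrite ?mulr0 ?mulr1 ?addr0 ?add0r.
Qed.

Let tailE n x k : (x - truncate n x) k = if (k < n)%N then 0 else x k.
Proof.
rewrite (_ : (x - truncate n x) k = x k - truncate n x k)// truncateE.
by case: ifP; rewrite ?subrr ?subr0.
Qed.

Let tail_lt (u : nat -> R[i]^o) (e : R) : in_seq_space X u -> 0 < e ->
  \forall n \near \oo, seq_norm X (fun k => if (k < n)%N then 0 else u k) < e.
Proof.
case: X => [p p1|] uX e0; last first.
  have e20 : 0 < e / 2 by rewrite divr_gt0.
  move/cvgrPdist_le : uX => /(_ _ e20)[N _ hN].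
  exists N => // n /= Nn; apply: (@le_lt_trans _ _ (e / 2)); last first.
    by rewrite ltr_pdivrMr// ltr_pMr// ltr1n.
  apply: ge_sup; first by exists (modulus (if (0 < n)%N then 0 else u 0%N)), 0%N.
  move=> _ [k _ <-]; case: ltnP => [_|nk]; first by rewrite modulus0 ltW.
  have := hN k (leq_trans Nn nk).
  by rewrite /= sub0r normrN ger0_norm ?modulus_ge0.
have p0 : 0 < p by rewrite (lt_le_trans ltr01).
pose f k := (modulus (u k) `^ p)%:E.
have f0 k : (0 <= f k)%E by rewrite lee_fin powR_ge0.
have : (fun n => fine (\sum_(n <= k <oo) f k)%E) @ \oo --> (0 : R).
  by apply: fine_cvg; apply: nneseries_tail_cvg.
move=> /cvgrPdist_lt/(_ _ (powR_gt0 p e0))[N _ hN].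
exists N => // n /= Nn; have := hN n Nn.
rewrite /= sub0r normrN ger0_norm ?fine_ge0 ?nneseries_ge0// => tail_e.
rewrite (_ : (\sum_(k <oo) _)%E = (\sum_(n <= k <oo) f k)%E); last first.
  rewrite [RHS]ereal_series_cond [RHS]eseries_mkcond.
  apply: eq_eseriesr => k _; rewrite andbT; case: ltnP => //= _.
  by rewrite modulus0 powR0// gt_eqF.
have -> : e = (e `^ p) `^ p^-1.
  by rewrite -powRrM mulfV ?gt_eqF// powRr1// ltW.
by apply: gt0_ltr_powR; rewrite ?invr_gt0// ?nnegrE ?powR_ge0 ?fine_ge0 ?nneseries_ge0.
Qed.

Let truncate_cvg x : truncate n x @[n --> \oo] --> x.
Proof.
apply/cvgrPdist_lt => e e0.
have eE : e = (modulus e)%:C by rewrite -modulusE gtr0_norm.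
have /(tail_lt (lseqP x)) : 0 < modulus e by rewrite -ltcR -eE.
apply: filterS => n; rewrite [X in `|_| < X]eE lseq_normE ltcR.
rewrite (_ : lseq_val (x - _) = fun k => if (k < n)%N then 0 else x k)//.
by apply/funext => k; rewrite tailE.
Qed.

Lemma closed_span_unit_vec :
  closed_span [set unit_vec n | n in [set n | (1 <= n)%N]] = setT.
Proof.
apply/seteqP; split => // x _ W [[Wc [W0 WD]] We].
apply: (@closed_cvg _ _ \oo _ _ W Wc _ _ (@truncate_cvg x)).
apply: nearW => n.
apply: (big_ind W) => // [y z Wy Wz|k _].
  by rewrite -[y]scale1r; exact: WD.
by rewrite -[X in W X]addr0; apply: WD => //; apply: We; exists k.+1.
Qed.

Let closed_span_image (T : {linear X -> X}) (A : set X) x : continuous T ->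
  closed_span A x -> closed_span (T @` A) (T x).
Proof.
move=> Tc Ax W [[Wc [W0 WD]] WA].
apply: (Ax (T @^-1` W)); split; last by move=> y Ay; apply: WA; exists y.
split; first by apply: preimage_closed => // y _; exact: Tc.
split; first by rewrite /preimage/= linear0.
by move=> a y z Wy Wz; rewrite /preimage/= linearP; exact: WD.
Qed.

Lemma X1E : X1 = range inj1.
Proof.
apply/seteqP; split=> [x|_ [x _ <-]].
  apply; split; last first.
    by move=> _ [n n1 <-]; exists (unit_vec n) => //; exact: inj1_unit_vec.
  split.
    rewrite (_ : range inj1 = coord2 @^-1` [set 0]).
      apply: preimage_closed; first by move=> y _; exact: coord2_continuous.
      apply: accessible_closed_set1; apply: hausdorff_accessible.
      exact: norm_hausdorff.
    apply/seteqP; split=> [_ [y _ <-]|y /= y0]; first exact: coord2_inj1.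
    by exists (coord1 y) => //; rewrite -[RHS]inj_coord y0 linear0 addr0.
  split; first by exists 0 => //; rewrite linear0.
  by move=> a _ _ [y _ <-] [z _ <-]; exists (a *: y + z); rewrite ?linearP.
have -> : X1 = closed_span
    (inj1 @` [set unit_vec n | n in [set n | (1 <= n)%N]]).
  congr closed_span; rewrite image_comp; apply: eq_imagel => n n1.
  by rewrite /= inj1_unit_vec.
apply: closed_span_image; first exact: inj1_continuous.
by rewrite closed_span_unit_vec.
Qed.

Lemma X2E : X2 = range inj2.
Proof.
apply/seteqP; split=> [x|_ [x _ <-]].
  apply; split; last first.
    by move=> _ [n n1 <-]; exists (unit_vec n) => //; exact: inj2_unit_vec.
  split.
    rewrite (_ : range inj2 = coord1 @^-1` [set 0]).
      apply: preimage_closed; first by move=> y _; exact: coord1_continuous.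
      apply: accessible_closed_set1; apply: hausdorff_accessible.
      exact: norm_hausdorff.
    apply/seteqP; split=> [_ [y _ <-]|y /= y0]; first exact: coord1_inj2.
    by exists (coord2 y) => //; rewrite -[RHS]inj_coord y0 linear0 add0r.
  split; first by exists 0 => //; rewrite linear0.
  by move=> a _ _ [y _ <-] [z _ <-]; exists (a *: y + z); rewrite ?linearP.
have -> : X2 = closed_span
    (inj2 @` [set unit_vec n | n in [set n | (1 <= n)%N]]).
  congr closed_span; rewrite image_comp; apply: eq_imagel => n n1.
  by rewrite /= inj2_unit_vec.
apply: closed_span_image; first exact: inj2_continuous.
by rewrite closed_span_unit_vec.
Qed.

Lemma X1_X2_direct_sum x :
  exists! x12 : X * X, [/\ X1 x12.1, X2 x12.2 & x = x12.1 + x12.2].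
Proof.
exists (inj1 (coord1 x), inj2 (coord2 x)); split.
  by rewrite X1E X2E inj_coord; split; [exists (coord1 x)|exists (coord2 x)|].
move=> [x1 x2] [/= + + ->]; rewrite X1E X2E => -[y _ <-] [z _ <-].
by rewrite !linearD/= coord1K coord2K coord1_inj2 coord2_inj1 !linear0 addr0 add0r.
Qed.

Lemma op_P_X1 x : X1 x -> op_P x = x.
Proof. by rewrite X1E => -[y _ <-]; rewrite op_PE coord1K. Qed.

Lemma op_P_X2 x : X2 x -> op_P x = 0.
Proof. by rewrite X2E => -[y _ <-]; rewrite op_PE coord1_inj2 linear0. Qed.

End operators.

(* Main.v *)
Require Import Defs.
From mathcomp Require Import all_boot all_order all_algebra.
From mathcomp Require Import complex.
From mathcomp Require Import all_classical all_reals all_analysis.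
From mathcomp Require Import ring lra.
From HB Require Import structures.

Import Order.TTheory GRing.Theory Num.Theory.
Import numFieldNormedType.Exports.

Local Open Scope ring_scope.

(** Write Q as the block matrix ((A, B), (C, D)). Then P Q - Q P is
    ((0, B), (-C, 0)), so it equals mu S_0 exactly when B = mu I and
    C = - mu S; given this, Q is idempotent if and only if (for mu <> 0)
    D = I - A and A^2 - A = mu^2 S. With T = 2A - I the last equation reads
    T^2 = I + 4 mu^2 S, so everything depends on whether I + aS, with
    a = 4 mu^2, has a square root among the operators commuting with S.

    Such an operator is determined by its value c at e_1: it acts on x as the
    Cauchy product with c ([shift_commutant]), because only the first n
    coordinates of x can contribute to the n-th coordinate of its image. Hence
    c must be a formal square root of 1 + az, and up to sign the only one is
    the binomial series, with coefficients binom(1/2, n) a^n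
    ([sqrt_coef_sqr], [cauchy_sqr_inj]).

    If |a| > 1 these coefficients grow faster than any bound, since
    |binom(1/2, n)| >= 1 / (2 n^2); but the coordinates of an element of X are
    bounded ([modulus_le1_of_shift_sqrt]). If |a| <= 1 they are absolutely
    summable, since the numbers |binom(1/2, n)| add up to 2, and convolution by
    an absolutely summable sequence is a bounded operator on X
    ([norm_convolution]), which is the required T ([shift_sqrt_exists]). The
    threshold |4 mu^2| <= 1 is |mu| <= 1/2. *)

(** * The power series of the square root of 1 + az *)

Definition cauchy_prod {F : pzRingType} (u v : nat -> F) (n : nat) : F :=
  \sum_(i < n.+1) u i * v (n - i)%N.

(** The generalized binomial coefficient binom(1/2, n). *)
Definition half_binom (F : fieldType) (n : nat) : F :=
  \prod_(i < n) ((1 - 2 * i%:R) / (2 * i.+1%:R)).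

Definition sqrt_coef {F : fieldType} (a : F) (n : nat) : F :=
  a ^+ n * half_binom F n.

(** The differential equation 2 (1 + az) f' = a f of f = sqrt (1 + az), read on
    coefficients. *)
Lemma sqrt_coefS (F : numFieldType) (a : F) (n : nat) :
  n.+1%:R * (2 * sqrt_coef a n.+1) = a * (1 - 2 * n%:R) * sqrt_coef a n.
Proof.
rewrite /sqrt_coef /half_binom big_ord_recr exprS /=.
have n0 : n.+1%:R != 0 :> F by rewrite pnatr_eq0.
by field; rewrite nat1r.
Qed.

(** For e = f^2 the equation 2 (1 + az) f' = a f gives (1 + az) e' = a e. On
    coefficients, symmetrising the weight i in the Cauchy product plays the
    role of the rule (f^2)' = 2 f f'. *)
Lemma sqrt_coef_sqr_rec (F : numFieldType) (a : F) (n : nat) :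
  let e := cauchy_prod (sqrt_coef a) (sqrt_coef a) in
  n.+1%:R * e n.+1 = a * (1 - n%:R) * e n.
Proof.
have weighted m : m%:R * cauchy_prod (sqrt_coef a) (sqrt_coef a) m =
    2 * \sum_(i < m.+1) i%:R * (sqrt_coef a i * sqrt_coef a (m - i)).
  rewrite [RHS]mulr_natl mulr2n {1}(reindex_inj rev_ord_inj) -big_split /=.
  rewrite /cauchy_prod mulr_sumr; apply: eq_bigr => i _.
  have im : (i <= m)%N by rewrite -ltnS.
  by rewrite subSS subKn// natrB//; ring.
move=> /=; rewrite weighted big_ord_recl mul0r add0r mulr_sumr.
transitivity (a * (cauchy_prod (sqrt_coef a) (sqrt_coef a) n
    - n%:R * cauchy_prod (sqrt_coef a) (sqrt_coef a) n)); last by ring.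
rewrite weighted /cauchy_prod mulr_sumr -sumrB mulr_sumr; apply: eq_bigr => i _.
rewrite lift0 subSS.
transitivity (i.+1%:R * (2 * sqrt_coef a i.+1) * sqrt_coef a (n - i)).
  by ring.
by rewrite sqrt_coefS; ring.
Qed.

Lemma sqrt_coef_sqr (F : numFieldType) (a : F) (n : nat) :
  cauchy_prod (sqrt_coef a) (sqrt_coef a) n =
  (n == 0%N)%:R + a * (n == 1%N)%:R.
Proof.
elim: n => [|n IHn].
  rewrite /cauchy_prod big_ord1 /sqrt_coef /half_binom subn0 big_ord0 /=.
  by ring.
have n0 : n.+1%:R != 0 :> F by rewrite pnatr_eq0.
apply: (mulfI n0); rewrite sqrt_coef_sqr_rec IHn.
by case: n {IHn n0} => [|[|n]] /=; ring.
Qed.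

(** The coefficient of index n.+1 of u^2 is 2 u_0 u_(n.+1) plus a term in
    u_1, ..., u_n, so u_0 and u^2 determine u recursively. *)
Lemma cauchy_sqr_inj (F : numFieldType) (u v : nat -> F) :
  u 0%N = v 0%N -> v 0%N != 0 ->
  cauchy_prod u u =1 cauchy_prod v v -> u =1 v.
Proof.
move=> uv0 v0 uv n; have [m] := ubnP n; elim: m n => // m IHm [//|n] nm.
have ends (w : nat -> F) : cauchy_prod w w n.+1 =
    2 * w 0%N * w n.+1 + \sum_(i < n) w i.+1 * w (n - i)%N.
  rewrite /cauchy_prod big_ord_recl big_ord_recr /= subn0 subSS subnn.
  by ring.
have := uv n.+1; rewrite !ends uv0.
rewrite (eq_bigr (fun i : 'I_n => v i.+1 * v (n - i)%N)) => [/addIr|i _].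
  by apply: mulfI; rewrite mulf_neq0// pnatr_eq0.
have nm' : (n < m)%N by [].
by rewrite !IHm//; apply: leq_ltn_trans nm'; rewrite ?leq_subr.
Qed.

Lemma normr_half_binomS (F : realFieldType) (n : nat) :
  `|half_binom F n.+2| =
  `|half_binom F n.+1| * ((2 * n%:R + 1) / (2 * n%:R + 4)).
Proof.
rewrite /half_binom big_ord_recr /= normrM; congr (_ * _).
have n0 : 0 <= n%:R :> F by [].
rewrite normrM normfV ler0_norm; last by rewrite -nat1r; lra.
rewrite ger0_norm; last by rewrite -!nat1r; lra.
by congr (_ / _); rewrite -!nat1r; ring.
Qed.

Lemma half_binom1 (F : realFieldType) : half_binom F 1 = 1 / 2.
Proof. by rewrite /half_binom big_ord1 /= mulr0 subr0 mulr1. Qed.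

(** The sum of binom(1/2, i) (-1)^i for i <= m is a partial sum of the series of
    (1 - z)^(1/2) at z = 1, that is, the coefficient of z^m in (1 - z)^(-1/2),
    which is (2m - 1) |binom(1/2, m)|. Its first term is 1 and the others are
    negative for m > 0, so the sum of the absolute values is 2 minus this
    coefficient. *)
Lemma sum_half_binom (F : realFieldType) (n : nat) :
  \sum_(i < n.+2) `|half_binom F i| =
  2 - (2 * n%:R + 1) * `|half_binom F n.+1|.
Proof.
elim: n => [|n IHn].
  rewrite big_ord_recr big_ord1 /= half_binom1 /half_binom big_ord0 normr1.
  by rewrite ger0_norm; lra.
have n0 : 0 <= n%:R :> F by [].
rewrite big_ord_recr IHn /= normr_half_binomS -nat1r.
by field; apply: lt0r_neq0; lra.
Qed.

Lemma sum_half_binom_le (F : realFieldType) (n : nat) :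
  \sum_(i < n) `|half_binom F i| <= 2.
Proof.
apply: (@le_trans _ _ (\sum_(i < n.+2) `|half_binom F i|)).
  by rewrite !big_ord_recr /= -addrA lerDl addr_ge0.
by rewrite sum_half_binom gerBl mulr_ge0// addr_ge0// mulr_ge0.
Qed.

(** The true order of decay is n^(-3/2); the exponent 2 is enough here and makes
    the product nondecreasing, by the ratio (n + 1) (2n - 1) / (2n^2) >= 1. *)
Lemma half_binom_lower (F : realFieldType) (n : nat) :
  1 / 2 <= n.+1%:R ^+ 2 * `|half_binom F n.+1|.
Proof.
elim: n => [|n IHn]; first by rewrite half_binom1 ger0_norm; lra.
apply: le_trans IHn _; rewrite normr_half_binomS mulrCA mulrC.
apply: ler_wpM2l => //; have n0 : 0 <= n%:R :> F by [].
rewrite mulrA ler_pdivlMr; last by lra.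
rewrite -!nat1r; nra.
Qed.

(** Bernoulli's inequality for r^m, cubed: r^(3m) is at least (m (r - 1))^3,
    which outgrows any multiple of (3m)^2. *)
Lemma exists_square_lt_exp (R : archiRealFieldType) (r K : R) : 1 < r ->
  exists n, K * n.+1%:R ^+ 2 < r ^+ n.+1.
Proof.
move=> r1.
have bern n : 1 + n%:R * (r - 1) <= r ^+ n.
  elim: n => [|n IHn]; first by rewrite mul0r addr0.
  rewrite exprSr; apply: le_trans (ler_wpM2r _ IHn); last by lra.
  have n0 : 0 <= n%:R :> R by [].
  have nt0 : 0 <= n%:R * (r - 1) ^+ 2 by rewrite mulr_ge0// sqr_ge0.
  by rewrite -nat1r; nra.
have t0 : 0 < (r - 1) ^+ 3 by rewrite exprn_gt0// subr_gt0.
have [m mK] : exists m, 9 * `|K| / (r - 1) ^+ 3 < m.+1%:R.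
  exists (Num.truncn (9 * `|K| / (r - 1) ^+ 3)).
  by apply: truncnS_gt.
exists (3 * m.+1).-1; rewrite prednK ?muln_gt0// mulnC exprM natrM.
set x : R := m.+1%:R in mK *; have x0 : 0 < x by [].
apply: (@lt_le_trans _ _ ((x * (r - 1)) ^+ 3)); last first.
  apply: lerXn2r; rewrite ?nnegrE.
  - by rewrite mulr_ge0 ?subr_ge0 ?ltW.
  - by rewrite exprn_ge0// ltW// (lt_trans ltr01).
  - by apply: le_trans (bern _); rewrite -/x; lra.
rewrite (_ : K * _ = x ^+ 2 * (9 * K)); last by ring.
have -> : (x * (r - 1)) ^+ 3 = x ^+ 2 * (x * (r - 1) ^+ 3) by ring.
rewrite ltr_pM2l ?exprn_gt0//.
rewrite -ltr_pdivrMr//; apply: le_lt_trans mK.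
rewrite ler_pM2r ?invr_gt0//; have := ler_norm K; lra.
Qed.

(** * Operators commuting with the shift *)

Section commutant.
Variables (R : realType) (X : seq_space R).
Implicit Types x : X.

Let tail_subproof x :
  in_seq_space X (fun k => x k.+1) /\
  seq_norm X (fun k => x k.+1) <= seq_norm X x.
Proof.
apply: (@in_seq_space_reindex_norm _ X (fun k => Some k.+1)) (lseqP x).
by move=> i j m [<-] [].
Qed.

Definition backward_shift x : X := mk_lseq (tail_subproof x).1.

Lemma head_tail x : x = x 0%N *: unit_vec X 1 + Defs.shift (backward_shift x).
Proof.
apply: lseq_ext => -[|k].
  change (x 0%N = x 0%N * 1 + 0); by rewrite mulr1 addr0.
change (x k.+1 = x 0%N * 0 + x k.+1); by rewrite mulr0 add0r.
Qed.

(** Peeling off the first coordinate, x = x_0 e_1 + S y, gives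
    L x = x_0 L e_1 + S (L y), and the n.+1-th coordinate of S (L y) is the n-th
    one of L y. *)
Lemma shift_commutant (L : {linear X -> X}) :
  (forall x, L (Defs.shift x) = Defs.shift (L x)) ->
  forall x n, L x n = cauchy_prod x (L (unit_vec X 1)) n.
Proof.
move=> Lshift x n; elim: n x => [|n IHn] x.
  rewrite [in LHS](head_tail x) linearP Lshift /cauchy_prod big_ord1.
  exact: addr0.
rewrite [in LHS](head_tail x) linearP Lshift /cauchy_prod big_ord_recl.
transitivity (x 0%N * L (unit_vec X 1) n.+1 + L (backward_shift x) n) => //.
rewrite IHn subn0; congr (_ + _); exact: eq_bigr.
Qed.

Lemma shift_commutant_ext (L M : {linear X -> X}) :
  (forall x, L (Defs.shift x) = Defs.shift (L x)) ->
  (forall x, M (Defs.shift x) = Defs.shift (M x)) ->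
  L (unit_vec X 1) = M (unit_vec X 1) -> L =1 M.
Proof.
move=> Ls Ms LM x; apply: lseq_ext => n.
by rewrite !shift_commutant// LM.
Qed.

End commutant.

(** * Convolution by an absolutely summable sequence *)

Section convolution.
Variables (R : realType) (X : seq_space R).

(** In l^p the bound on the norms passes to the partial sums of the p-th powers
    of the limit. In c_0 it shows only that the limit is bounded, and it is the
    uniform convergence that makes it tend to 0. *)
Lemma seq_space_limit (y : nat -> R[i]^o) (z : nat -> X) (M : R) :
  (forall n k, (k < n)%N -> z n k = y k) ->
  (forall n, seq_norm X (z n) <= M) ->
  (forall e, 0 < e -> exists n, forall k, modulus (y k - z n k) <= e) ->
  in_seq_space X y /\ seq_norm X y <= M.
Proof.
case: X z => [p p1|] z zy zM zc.
  have p0 : 0 < p by rewrite (lt_le_trans ltr01).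
  have psum_ge0 (u : nat -> R[i]^o) :
      (0 <= \sum_(n <oo) (modulus (u n) `^ p)%:E)%E.
    by apply: nneseries_ge0 => *; rewrite lee_fin powR_ge0.
  have psum_le : (\sum_(n <oo) (modulus (y n) `^ p)%:E <= (M `^ p)%:E)%E.
    apply: lime_le.
      by apply: is_cvg_nneseries => *; rewrite lee_fin powR_ge0.
    apply: nearW => n.
    have zfin : (\sum_(k <oo) (modulus (z n k) `^ p)%:E \is a fin_num)%E.
      by rewrite ge0_fin_numE//; exact: (lseqP (z n)).
    apply: (@le_trans _ _ (\sum_(k <oo) (modulus (z n k) `^ p)%:E)%E).
      apply: (@le_trans _ _ (\sum_(0 <= k < n) (modulus (z n k) `^ p)%:E)%E).
        by rewrite !big_mkord; apply: lee_sum => k _; rewrite zy.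
      by apply: nneseries_lim_ge => *; rewrite lee_fin powR_ge0.
    rewrite -(fineK zfin) lee_fin.
    have -> : fine (\sum_(k <oo) (modulus (z n k) `^ p)%:E)%E =
        seq_norm (ellp p1) (z n) `^ p.
      by rewrite /= -powRrM mulVf ?gt_eqF// powRr1// fine_ge0.
    apply: ge0_ler_powR; rewrite ?nnegrE ?(ltW p0) ?powR_ge0//.
    exact: le_trans (powR_ge0 _ _) (zM n).
  have yX : in_seq_space (ellp p1) y by exact: le_lt_trans psum_le (ltry _).
  split=> //=; have M0 : 0 <= M by exact: le_trans (powR_ge0 _ _) (zM 0%N).
  rewrite -[M]powRr1// -(@mulfV _ p) ?gt_eqF// powRrM.
  apply: ge0_ler_powR; rewrite ?nnegrE ?invr_ge0 ?(ltW p0) ?powR_ge0 ?fine_ge0//.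
  by rewrite -lee_fin fineK// ge0_fin_numE.
split; last first.
  apply: ge_sup; first by exists (modulus (y 0%N)), 0%N.
  move=> _ [k _ <-]; rewrite -(zy k.+1 k)//; apply: le_trans (zM k.+1).
  exact: modulus_le_seq_norm k (lseqP (z k.+1)).
apply/cvgrPdist_le => e e0; have e20 : 0 < e / 2 by rewrite divr_gt0.
have [n zn] := zc _ e20.
move/cvgrPdist_le : (lseqP (z n)) => /(_ _ e20); apply: filterS => k.
rewrite !sub0r !normrN !ger0_norm ?modulus_ge0// => zk.
have -> : y k = z n k + (y k - z n k) by rewrite addrC subrK.
apply: le_trans (modulusD _ _) _.
by rewrite [leRHS]splitr lerD.
Qed.

Lemma iter_shiftE j (x : X) k :
  iter j (@Defs.shift R X) x k = if (j <= k)%N then x (k - j)%N else 0.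
Proof.
elim: j k => [|j IHj] k; first by rewrite subn0.
by case: k => [//|k]; rewrite iterS /= IHj.
Qed.

Lemma norm_iter_shift j (x : X) : `|iter j (@Defs.shift R X) x| <= `|x|.
Proof.
by elim: j => //= j IHj; exact: le_trans (norm_shift _) IHj.
Qed.

Variables (b : nat -> R[i]) (K : R).
Hypothesis sum_b : forall n, \sum_(j < n) modulus (b j) <= K.

Let partial n (x : X) : X := \sum_(j < n) b j *: iter j (@Defs.shift R X) x.

(** No power of S increases norms, so the partial sums of the operators b_j S^j
    are Cauchy as soon as those of the moduli of b are. *)
Let partialB m n x : (m <= n)%N -> `|partial n x - partial m x| <=
  (\sum_(j < n) modulus (b j) - \sum_(j < m) modulus (b j))%:C%C * `|x|.
Proof.
move=> /subnK <-; elim: (n - m)%N => [|d IHd].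
  by rewrite add0n !subrr normr0 mul0r.
rewrite addSn /partial !big_ord_recr /= -/(partial _ x) -/(partial m x).
rewrite addrAC [X in _ <= X%:C%C * _]addrAC rmorphD mulrDl.
apply: le_trans (ler_normD _ _) _; apply: lerD => //.
rewrite normrZ modulusE; apply: ler_wpM2l; first by rewrite ler0c modulus_ge0.
exact: norm_iter_shift.
Qed.

Let partial_norm n x : seq_norm X (partial n x) <= K * seq_norm X x.
Proof.
rewrite -lecR rmorphM -!lseq_normE.
have := partialB 0%N n x (leq0n n).
rewrite /partial !big_ord0 !subr0 => /le_trans; apply.
by apply: ler_wpM2r => //; rewrite lecR.
Qed.

Let partialE n (x : X) k : (k < n)%N -> partial n x k = cauchy_prod b x k.
Proof.
move=> kn.
have -> : partial n x k = \sum_(j < n) b j * iter j (@Defs.shift R X) x k.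
  rewrite /partial; elim: n {kn} => [|n IHn]; first by rewrite !big_ord0.
  by rewrite !big_ord_recr /= -IHn.
under eq_bigr do rewrite iter_shiftE.
rewrite -(subnKC kn) big_split_ord /= [X in _ + X]big1 => [|j _].
  rewrite addr0; apply: eq_bigr => j _.
  by rewrite -ltnS ltn_ord.
by rewrite leqNgt ltnS leq_addr mulr0.
Qed.

Let cauchy_prod_bounded (x : X) :
  in_seq_space X (cauchy_prod b x) /\
  seq_norm X (cauchy_prod b x) <= K * seq_norm X x.
Proof.
apply: (@seq_space_limit _ (partial ^~ x)) => [n k||e e0].
- exact: partialE.
- by move=> n; exact: partial_norm.
set s := fun n => \sum_(j < n) modulus (b j).
have x0 : 0 <= seq_norm X x.
  by apply: le_trans (modulus_le_seq_norm 0%N (lseqP x)); exact: modulus_ge0.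
have e1 : 0 < e / (seq_norm X x + 1) by rewrite divr_gt0// ltr_wpDl.
(* Past an index where the partial sum is within e / (|x| + 1) of the supremum,
   the remaining terms contribute at most e; the +1 guards against x = 0. *)
have s_sup : has_sup (range s).
  by split; [exists (s 0%N), 0%N | exists K => _ [n _ <-]; exact: sum_b].
have [_ [n _ <-] sn] := sup_adherent e1 s_sup.
exists n => k; have [kn|nk] := ltnP k n.
  by rewrite partialE// subrr modulus0 ltW.
rewrite -(partialE k.+1 x k (ltnSn k)).
apply: le_trans (modulus_le_seq_norm k (lseqP (partial k.+1 x - partial n x))) _.
rewrite -lecR -lseq_normE; apply: le_trans (partialB n k.+1 x (leqW nk)) _.
rewrite lseq_normE -rmorphM lecR.
apply: (@le_trans _ _ (e / (seq_norm X x + 1) * seq_norm X x)).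
  apply: ler_wpM2r => //; rewrite lerBlDr -lerBlDl.
  apply: le_trans (ltW sn); rewrite lerB//.
  by apply: ub_le_sup; [exact: s_sup.2 | exists k.+1].
by rewrite mulrAC ler_pdivrMr ?ltr_wpDl// ler_pM2l// lerDl.
Qed.

Definition convolution (x : X) : X := mk_lseq (cauchy_prod_bounded x).1.

Lemma norm_convolution x : `|convolution x| <= K%:C%C * `|x|.
Proof.
by rewrite !lseq_normE -rmorphM lecR; exact: (cauchy_prod_bounded x).2.
Qed.

Let convolution_linear : linear convolution.
Proof.
move=> a x y; apply: lseq_ext => n.
change (cauchy_prod b (a *: x + y) n =
  a * cauchy_prod b x n + cauchy_prod b y n).
rewrite /cauchy_prod mulr_sumr -big_split /=; apply: eq_bigr => i _.
by rewrite mulrDr mulrCA.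
Qed.
HB.instance Definition _ :=
  GRing.isLinear.Build R[i] X X _ convolution convolution_linear.

Lemma convolution_shift x : convolution (Defs.shift x) = Defs.shift (convolution x).
Proof.
apply: lseq_ext => -[|n]; first by rewrite /= /cauchy_prod big_ord1 mulr0.
rewrite /= /cauchy_prod big_ord_recr /= subnn mulr0 addr0.
by apply: eq_bigr => i _; rewrite subSn// -ltnS.
Qed.

Lemma convolution_unit_vec : convolution (unit_vec X 1) =1 b.
Proof.
move=> n; rewrite /= /cauchy_prod big_ord_recr /= subnn eqxx mulr1.
rewrite big1 ?add0r// => i _.
by rewrite eqSS subn_eq0 leqNgt ltn_ord mulr0.
Qed.

End convolution.

(** * Bounded operators *)

Section bounded_operators.
Variables (R : realType) (V : normedModType R[i]).
Implicit Types S T : V -> V.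

Lemma nonexpansive_bounded T :
  (forall x, `|T x| <= `|x|) -> bounded_operator T.
Proof. by move=> TM; exists 1 => x; rewrite mul1r. Qed.

Lemma bounded_operatorD S T : bounded_operator S -> bounded_operator T ->
  bounded_operator (fun x => S x + T x).
Proof.
move=> [K SK] [M TM]; exists (K + M) => x.
rewrite rmorphD mulrDl; apply: le_trans (ler_normD _ _) _.
exact: lerD.
Qed.

Lemma bounded_operatorZ (a : R[i]) T : bounded_operator T ->
  bounded_operator (fun x => a *: T x).
Proof.
move=> [M TM]; exists (modulus a * M) => x.
by rewrite normrZ modulusE rmorphM -mulrA ler_wpM2l// ler0c modulus_ge0.
Qed.

Lemma bounded_operator_comp S T : bounded_operator S -> bounded_operator T ->
  bounded_operator (S \o T).
Proof.
(* On the zero space the bound K may be negative. *)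
move=> [K SK] [M TM]; exists (`|K| * M) => x.
apply: le_trans (SK _) _; rewrite rmorphM -mulrA.
apply: (@le_trans _ _ (`|K|%:C%C * `|T x|)).
  by apply: ler_wpM2r => //; rewrite lecR ler_norm.
by apply: ler_wpM2l; rewrite ?ler0c.
Qed.

End bounded_operators.

(** * Square roots of I + aS and commutators *)

Section commutators.
Variables (R : realType) (X : seq_space R).

(** Together with [lseq_ext], this turns vector identities in X into scalar
    ones, which [ring] and [field] decide. *)
Lemma lseqE :
  (forall (x y : X) n, (x + y) n = x n + y n :> R[i]) *
  (forall (x : X) n, (- x) n = - x n :> R[i]) *
  (forall k (x : X) n, (k *: x) n = k * x n :> R[i]).
Proof. by []. Qed.

Lemma modulus_sqrt_coef (a : R[i]) n :
  modulus (sqrt_coef a n) = modulus a ^+ n * `|half_binom R n|.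
Proof.
have modulusX m : modulus (a ^+ m) = modulus a ^+ m.
  elim: m => [|m IHm]; last by rewrite !exprS modulusM IHm.
  by rewrite /modulus !expr0 normr1.
rewrite modulusM modulusX; congr (_ * _).
have -> : half_binom R[i] n = (half_binom R n)%:C%C.
  rewrite rmorph_prod; apply: eq_bigr => i _.
  by rewrite fmorph_div rmorphB !rmorphM !rmorph_nat rmorph1.
by rewrite /modulus normc_def /= expr0n addr0 sqrtr_sqr.
Qed.

(** The coordinates of T e_1 are the coefficients of a formal square root of
    1 + az, hence binom(1/2, n) a^n up to sign; as coordinates of an element of
    X they are bounded. *)
Lemma modulus_le1_of_shift_sqrt (a : R[i]) (T : {linear X -> X}) :
  (forall x, T (Defs.shift x) = Defs.shift (T x)) ->
  (forall x, T (T x) = x + a *: Defs.shift x) ->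
  modulus a <= 1.
Proof.
move=> Tshift Tsqr; set c : nat -> R[i] := T (unit_vec X 1).
have c_sqr n : cauchy_prod c c n = (n == 0%N)%:R + a * (n == 1%N)%:R.
  rewrite -(shift_commutant R X T Tshift) Tsqr.
  by case: n => [|[|n]].
have c0 : c 0%N * c 0%N = 1.
  by have := c_sqr 0%N; rewrite /cauchy_prod big_ord1 mulr0 addr0.
have c0N : c 0%N != 0.
  by apply: contra_eq_neq c0 => ->; rewrite mul0r eq_sym oner_eq0.
have cE : c =1 (fun n => c 0%N * sqrt_coef a n).
  have s0 : sqrt_coef a 0 = 1.
    by rewrite /sqrt_coef /half_binom big_ord0 mulr1.
  apply: cauchy_sqr_inj => [||n]; rewrite ?s0 ?mulr1//.
  rewrite c_sqr -sqrt_coef_sqr -[LHS]mul1r -c0 mulr_sumr.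
  by apply: eq_bigr => i _; ring.
have c0_mod : modulus (c 0%N) = 1.
  have m2 : modulus (c 0%N) ^+ 2 = 1.
    by rewrite expr2 -modulusM c0 /modulus normr1.
  have := modulus_ge0 (c 0%N).
  by move/eqP: m2; rewrite sqrf_eq1 => /orP[] /eqP -> //; rewrite ler0N1.
rewrite leNgt; apply/negP => a1.
have [n] := exists_square_lt_exp R (modulus a) (2 * seq_norm X (T (unit_vec X 1))) a1.
apply/negP; rewrite -leNgt.
have cn := modulus_le_seq_norm n.+1 (lseqP (T (unit_vec X 1))).
have cnE : modulus (c n.+1) = modulus a ^+ n.+1 * `|half_binom R n.+1|.
  by rewrite cE modulusM c0_mod mul1r modulus_sqrt_coef.
have low := half_binom_lower R n.
move: cn; rewrite -/(c n.+1) cnE; set r := modulus a ^+ n.+1.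
set h := `|_|; set M := seq_norm X _; set N := n.+1%:R ^+ 2 => rh.
have r0 : 0 <= r by rewrite exprn_ge0// modulus_ge0.
have N0 : 0 <= N by rewrite exprn_ge0.
have : r * (1 / 2) <= r * (N * h) by rewrite ler_wpM2l.
have : N * (r * h) <= N * M by rewrite ler_wpM2l.
by rewrite mulrCA; lra.
Qed.

(** T is convolution by the binomial coefficients. Both T^2 and I + aS commute
    with S, so they agree as soon as they agree at e_1, where the claim is that
    the square of the binomial series is 1 + az. *)
Lemma shift_sqrt_exists (a : R[i]) : modulus a <= 1 ->
  exists T : {linear X -> X}, [/\ bounded_operator T,
    forall x, T (Defs.shift x) = Defs.shift (T x) &
    forall x, T (T x) = x + a *: Defs.shift x].
Proof.
move=> a1.
have sum_le n : \sum_(j < n) modulus (sqrt_coef a j) <= 2.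
  apply: le_trans (sum_half_binom_le R n); apply: ler_sum => j _.
  rewrite modulus_sqrt_coef ler_piMl// exprn_ile1// modulus_ge0//.
pose T : {linear X -> X} := convolution R X (sqrt_coef a) 2 sum_le.
have Tshift x : T (Defs.shift x) = Defs.shift (T x).
  exact: convolution_shift.
exists T; split=> //.
  by exists 2 => x; exact: norm_convolution.
pose M : {linear X -> X} := idfun \+ (a \*: @Defs.shift R X).
apply: (shift_commutant_ext R X (T \o T) M) => [x|x|] /=.
- by rewrite !Tshift.
- by rewrite linearD linearZ.
apply: lseq_ext => n; rewrite (shift_commutant R X T Tshift).
transitivity (cauchy_prod (sqrt_coef a) (sqrt_coef a) n).
  by apply: eq_bigr => i _; rewrite !convolution_unit_vec.
by rewrite sqrt_coef_sqr; case: n => [|[|n]].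
Qed.

Lemma op_S0_block (x : X) :
  op_S0 X x = inj1 (coord2 x) + inj2 (Defs.shift (coord1 x)).
Proof. by rewrite /op_S0 /= /block_op /= add0r addr0. Qed.

(** T = 2A - I for the upper left block A of Q. That A commutes with S is a
    consequence of mu^2 S = A^2 - A, hence the condition mu != 0: for mu = 0
    the block A can be any idempotent. *)
Lemma shift_sqrt_of_commutator (mu : R[i]) (Q : {linear X -> X}) :
  mu != 0 -> idempotent_operator Q ->
  is_commutator (fun x : X => mu *: op_S0 X x) (op_P X) Q ->
  exists T : {linear X -> X},
    (forall x, T (Defs.shift x) = Defs.shift (T x)) /\
    (forall x, T (T x) = x + (4 * mu ^+ 2) *: Defs.shift x).
Proof.
move=> mu0 Qidem comm.
pose A : {linear X -> X} := @coord1 R X \o Q \o @inj1 R X.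
have Q12 y : coord1 (Q (inj2 y)) = mu *: y.
  have := congr1 (@coord1 R X) (comm (inj2 y)).
  rewrite op_S0_block !op_PE coord2K coord1_inj2 !linear0 !addr0 coord1K => <-.
  by rewrite linearZ /= coord1K.
have Q21 y : coord2 (Q (inj1 y)) = - mu *: Defs.shift y.
  have := congr1 (@coord2 R X) (comm (inj1 y)).
  rewrite op_S0_block !op_PE coord2_inj1 coord1K linear0 add0r linearB /= coord2_inj1.
  by rewrite linearZ /= coord2K sub0r scaleNr => ->; rewrite opprK.
have Asqr y : A (A y) = A y + mu ^+ 2 *: Defs.shift y.
  have AAy : A (A y) + mu *: (- mu *: Defs.shift y) = A y.
    have := congr1 (@coord1 R X) (Qidem (inj1 y)).
    by rewrite -[X in Q X]inj_coord linearD linearD /= Q21 Q12.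
  rewrite -[X in _ = X + _]AAy scalerA -addrA -scalerDl.
  by rewrite mulrN -expr2 addNr scale0r addr0.
have Ashift y : A (Defs.shift y) = Defs.shift (A y).
  have mu2 : mu ^+ 2 != 0 by rewrite expf_neq0.
  apply: (scalerI mu2); rewrite -linearZ.
  have -> : mu ^+ 2 *: Defs.shift y = A (A y) - A y.
    by rewrite Asqr addrC addKr.
  by rewrite linearB (Asqr (A y)) addrC addKr.
exists (2 \*: A \- idfun); split=> x.
  change (2 *: A (Defs.shift x) - Defs.shift x =
    Defs.shift (2 *: A x - x)).
  by rewrite Ashift linearB linearZ.
change (2 *: A (2 *: A x - x) - (2 *: A x - x) =
  x + (4 * mu ^+ 2) *: Defs.shift x).
rewrite linearB linearZ Asqr; move: (A x) (Defs.shift x) => u v.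
apply: lseq_ext => n.
rewrite !lseqE.
by ring.
Qed.

(** The block matrix with diagonal (I + T) / 2, (I - T) / 2 and off-diagonal
    entries mu I, - mu S is idempotent because T commutes with S and
    T^2 = I + 4 mu^2 S. *)
Lemma commutator_of_shift_sqrt (mu : R[i]) (T : {linear X -> X}) :
  bounded_operator T ->
  (forall x, T (Defs.shift x) = Defs.shift (T x)) ->
  (forall x, T (T x) = x + (4 * mu ^+ 2) *: Defs.shift x) ->
  exists Q : {linear X -> X},
     [/\ bounded_operator Q, idempotent_operator Q &
         is_commutator (fun x : X => mu *: op_S0 X x) (op_P X) Q].
Proof.
move=> [M TM] Tshift Tsqr.
pose A : {linear X -> X} := 2^-1 \*: (idfun \+ T).
pose D : {linear X -> X} := 2^-1 \*: (idfun \- T).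
pose B : {linear X -> X} := mu \*: idfun.
pose C : {linear X -> X} := (- mu) \*: @Defs.shift R X.
have AE x : A x = 2^-1 *: (x + T x) by [].
have DE x : D x = 2^-1 *: (x - T x) by [].
have BE x : B x = mu *: x by [].
have CE x : C x = - mu *: Defs.shift x by [].
pose Q : {linear X -> X} := block_op A B C D.
have QE x : Q x = inj1 (A (coord1 x) + B (coord2 x)) +
    inj2 (C (coord1 x) + D (coord2 x)) by [].
have c1 (x y : X) : coord1 (inj1 x + inj2 y) = x.
  by rewrite linearD /= coord1K coord1_inj2 addr0.
have c2 (x y : X) : coord2 (inj1 x + inj2 y) = y.
  by rewrite linearD /= coord2K coord2_inj1 add0r.
have c1Q x : coord1 (Q x) = A (coord1 x) + B (coord2 x) by rewrite QE c1.
have c2Q x : coord2 (Q x) = C (coord1 x) + D (coord2 x) by rewrite QE c2.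
have TDZ (k l : R[i]) (x y : X) : T (k *: x + l *: y) = k *: T x + l *: T y.
  by rewrite linearD !linearZ.
have SDZ (k l : R[i]) (x y : X) :
    Defs.shift (k *: x + l *: y) = k *: Defs.shift x + l *: Defs.shift y.
  by rewrite linearD !linearZ.
exists Q; split.
- have bid : bounded_operator (@idfun X) by exact: nonexpansive_bounded.
  have bT : bounded_operator T by exists M.
  have bS : bounded_operator (@Defs.shift R X).
    exact/nonexpansive_bounded/norm_shift.
  have bA : bounded_operator A.
    exact/bounded_operatorZ/bounded_operatorD.
  have bD : bounded_operator D.
    apply/bounded_operatorZ/bounded_operatorD => //.
    by case: bT => K TK; exists K => x; rewrite normrN.
  have bB : bounded_operator B by exact: bounded_operatorZ.
  have bC : bounded_operator C by exact: bounded_operatorZ.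
  have b1 : bounded_operator (@coord1 R X).
    exact/nonexpansive_bounded/norm_coord1.
  have b2 : bounded_operator (@coord2 R X).
    exact/nonexpansive_bounded/norm_coord2.
  apply: bounded_operatorD.
    apply: (bounded_operator_comp R X (@inj1 R X)).
      exact/nonexpansive_bounded/norm_inj1.
    by apply: bounded_operatorD; exact: bounded_operator_comp.
  apply: (bounded_operator_comp R X (@inj2 R X)).
    exact/nonexpansive_bounded/norm_inj2.
  by apply: bounded_operatorD; exact: bounded_operator_comp.
- move=> x; rewrite QE c1Q c2Q [RHS]QE.
  move: (coord1 x) (coord2 x) => u v.
  congr (inj1 _ + inj2 _); rewrite !(AE, BE, CE, DE) ?TDZ ?SDZ.
    rewrite !linearD !linearN Tsqr.
    apply: lseq_ext => n.
    rewrite !lseqE.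
    by field.
  rewrite !linearD !linearN Tshift.
  apply: lseq_ext => n; rewrite !lseqE Tsqr !lseqE.
  by field.
move=> x; rewrite !op_PE c1Q QE coord1K coord2_inj1.
rewrite op_S0_block (linear0 B) (linear0 D) !addr0 BE CE.
move: (A (coord1 x)) => Au; rewrite !linearD !linearZ.
apply: lseq_ext => n; rewrite !lseqE.
by ring.
Qed.

End commutators.

Theorem theorem3p2 (R : realType) (X : seq_space R) (mu : R[i]) :
  (exists Q : {linear X -> X},
     [/\ bounded_operator Q, idempotent_operator Q &
         is_commutator (fun x : X => mu *: op_S0 X x) (op_P X) Q]) <->
  `|mu| <= 1 / 2.
Proof.
have half : (`|mu| <= 1 / 2) = (modulus (4 * mu ^+ 2) <= 1).
  rewrite !modulusM.
  have -> : modulus (4 : R[i]) = 4.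
    by apply: complexI; rewrite -modulusE normr_nat rmorph_nat.
  have -> : 1 / 2 = (1 / 2)%:C%C :> R[i].
    by rewrite fmorph_div rmorph1 rmorph_nat.
  rewrite modulusE lecR; have := modulus_ge0 mu.
  by move: (modulus mu) => m m0; apply/idP/idP => ?; nra.
rewrite half; split=> [[Q [_ Qidem comm]]|mu_le].
  have [->|mu0] := eqVneq mu 0.
    by rewrite expr0n mulr0 modulus0.
  have [T [Tshift Tsqr]] := shift_sqrt_of_commutator R X mu Q mu0 Qidem comm.
  exact: modulus_le1_of_shift_sqrt Tshift Tsqr.
have [T [Tbnd Tshift Tsqr]] := shift_sqrt_exists R X _ mu_le.
exact: commutator_of_shift_sqrt Tbnd Tshift Tsqr.
Qed.
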